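(* Let $k$ be a commutative ring, $A$ and $B$ $k$-algebras, $M$ a faithful left $A$-module, and $N$ a faithful left $B$-module. Suppose, moreover, that elements of $M$ can be separated by $k$-module homomorphisms $M\to k$ (that is, for any two distinct elements $x,y\in M$ there is a $k$-module homomorphism $\varphi:M\to k$ with $\varphi(x)\neq\varphi(y)$), and that every finite subset of $B$ is contained in a free $k$-submodule of $B$. Then the left $A\otimes_k B$-module $M\otimes_k N$ is again faithful.
   Context: Commutative rings $k$ are unital. Algebras are associative but not necessarily unital. A left module $M$ over a $k$-algebra $A$ is a $k$-module with a $k$-algebra homomorphism (not required to preserve units) $A\to\mathrm{End}_k(M)$; it is faithful if this map is one-to-one, i.e. every nonzero element of $A$ acts as a nonzero map on $M$. Given a left $A$-module $M$ and a left $B$-module $N$, the $k$-module $M\otimes_k N$ is a left $A\otimes_k B$-module via: an element $f=\sum_{1\le i\le n} a_i\otimes b_i\in A\otimes_k B$ ($a_i\in A$, $b_i\in B$) acts by $u\otimes v\mapsto \sum_i a_iu\otimes b_iv$ for $u\in M$, $v\in N$, extended $k$-linearly to all of $M\otimes_k N$. *)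

(* Defs.v *)
From HB Require Import structures.
From mathcomp Require Import all_boot all_algebra.
From mathcomp Require Import boolp classical_sets.

Set Implicit Arguments.
Unset Strict Implicit.
Unset Printing Implicit Defensive.

Import GRing.Theory.
Local Open Scope ring_scope.
Local Open Scope quotient_scope.

(* The base ring ranges over comPzRingType, so the zero ring is allowed.       *)

Definition is_bilinear (k : comPzRingType) (U V W : lmodType k)
    (f : U -> V -> W) : Prop :=
  (forall v, linear (f ^~ v)) /\ (forall u, linear (f u)).

(* MathComp's algType is unital; here no unit is required. *)
HB.mixin Record isNuAlgebra (k : comPzRingType) A of GRing.Lmodule k A := {
  amul : A -> A -> A;
  amulA : associative amul;
  amul_bilinear : is_bilinear amul
}.

#[short(type="nuAlgType")]
HB.structure Definition NuAlgebra (k : comPzRingType) :=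
  {A of isNuAlgebra k A & GRing.Lmodule k A}.

(* The action is the uncurried form of a homomorphism A -> End_k(M) of        *)
(* nonunital k-algebras: act is k-linear in its first argument, act a is in   *)
(* End_k(M), and products act by composition.  The k-module structure of M is *)
(* the inherited lmodType one.                                                *)
HB.mixin Record isLeftModule (k : comPzRingType) (A : nuAlgType k) M
    of GRing.Lmodule k M := {
  act : A -> M -> M;
  act_bilinear : is_bilinear act;
  actM : forall (a b : A) (x : M), act (amul a b) x = act a (act b x)
}.

#[short(type="leftModType")]
HB.structure Definition LeftModule (k : comPzRingType) (A : nuAlgType k) :=
  {M of isLeftModule k A M & GRing.Lmodule k M}.

(* A -> End_k(M) is one-to-one. *)
Definition faithful (k : comPzRingType) (A : nuAlgType k)
    (M : leftModType A) : Prop :=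
  forall a b : A, (forall x : M, act a x = act b x) -> a = b.

Section FreeSubmodule.
Variables (k : comPzRingType) (B : lmodType k).
Implicit Types (F E : set B).

Definition linearly_independent E : Prop :=
  forall (s : seq B) (c : B -> k),
    uniq s -> (forall e, e \in s -> E e) ->
    \sum_(e <- s) c e *: e = 0 -> forall e, e \in s -> c e = 0.

Definition is_span E F : Prop :=
  forall x, F x <-> exists (s : seq B) (c : B -> k),
    (forall e, e \in s -> E e) /\ x = \sum_(e <- s) c e *: e.

(* The basis E may be infinite. *)
Definition free_submodule F : Prop :=
  GRing.submod_closed [in F] /\
  exists E : set B, linearly_independent E /\ is_span E F.
End FreeSubmodule.

Section TensorDef.
Variables (k : comPzRingType) (M N : lmodType k).

(* M (x) N is built as the commutative monoid of formal sums of pairs (m, n)  *)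
(* modulo the congruence generated by the bilinearity relations; opposites    *)
(* come for free as (- m, n).  tensor_universal below is the usual universal  *)
(* property.                                                                  *)
Inductive tensor_eq : seq (M * N) -> seq (M * N) -> Prop :=
| teq_refl s : tensor_eq s s
| teq_sym s t : tensor_eq s t -> tensor_eq t s
| teq_trans s t u : tensor_eq s t -> tensor_eq t u -> tensor_eq s u
| teq_cat s s' t t' :
    tensor_eq s s' -> tensor_eq t t' -> tensor_eq (s ++ t) (s' ++ t')
| teq_comm s t : tensor_eq (s ++ t) (t ++ s)
| teq_zero n : tensor_eq [:: (0, n)] [::]
| teq_addl m m' n : tensor_eq [:: (m + m', n)] [:: (m, n); (m', n)]
| teq_addr m n n' : tensor_eq [:: (m, n + n')] [:: (m, n); (m, n')]
| teq_scale (a : k) m n : tensor_eq [:: (a *: m, n)] [:: (m, a *: n)].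

Definition tensor_eqb : rel (seq (M * N)) := fun s t => `[< tensor_eq s t >].

Lemma tensor_eqb_equiv : equiv_class_of tensor_eqb.
Proof.
split=> [s | s t | s t u]; rewrite /tensor_eqb.
- by apply/asboolP; exact: teq_refl.
- by apply/asboolP/asboolP; exact: teq_sym.
- by move=> /asboolP + /asboolP h; move=> h'; apply/asboolP; apply: teq_trans h.
Qed.

Canonical tensor_equiv := EquivRelPack tensor_eqb_equiv.

Definition tensor : Type := {eq_quot tensor_equiv}.
HB.instance Definition _ := Choice.on tensor.
HB.instance Definition _ := EqQuotient.on tensor.
End TensorDef.

Notation "M ⊗ N" := (tensor M N) (at level 40, left associativity) : type_scope.

Section TensorModule.
Variables (k : comPzRingType) (M N : lmodType k).
Local Notation T := (tensor M N).
Implicit Types (s t : seq (M * N)) (x y z : T) (a b : k).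

Definition tsum s : T := \pi_T s.

Lemma tsumP s t : tensor_eq s t <-> tsum s = tsum t.
Proof.
split=> [h | /eqmodP/asboolP //].
by apply/eqmodP/asboolP.
Qed.

Lemma tsum_repr x : tsum (repr x) = x.
Proof. exact: reprK. Qed.

Lemma repr_tsum s : tensor_eq (repr (tsum s)) s.
Proof. by apply/tsumP; rewrite tsum_repr. Qed.

Definition pure (m : M) (n : N) : T := tsum [:: (m, n)].

Definition tscale_seq a s := [seq (a *: p.1, p.2) | p <- s].

Lemma tscale_seqP a s t :
  tensor_eq s t -> tensor_eq (tscale_seq a s) (tscale_seq a t).
Proof.
elim=> {s t} /=.
- by move=> s; exact: teq_refl.
- by move=> s t _; exact: teq_sym.
- by move=> s t u _ h1 _ h2; exact: teq_trans h1 h2.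
- by move=> s s' t t' _ h1 _ h2; rewrite /tscale_seq !map_cat; exact: teq_cat.
- by move=> s t; rewrite /tscale_seq !map_cat; exact: teq_comm.
- by move=> n; rewrite scaler0; exact: teq_zero.
- by move=> m m' n; rewrite scalerDr; exact: teq_addl.
- by move=> m n n'; exact: teq_addr.
- move=> b m n; rewrite scalerA mulrC -scalerA; exact: teq_scale.
Qed.

Definition tadd x y : T := tsum (repr x ++ repr y).
Definition tzero : T := tsum [::].
Definition tscale a x : T := tsum (tscale_seq a (repr x)).
Definition topp x : T := tscale (- 1) x.

Lemma taddE s t : tadd (tsum s) (tsum t) = tsum (s ++ t).
Proof. by apply/tsumP; apply: teq_cat; exact: repr_tsum. Qed.

Lemma tscaleE a s : tscale a (tsum s) = tsum (tscale_seq a s).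
Proof. by apply/tsumP/tscale_seqP; exact: repr_tsum. Qed.

Lemma taddA : associative tadd.
Proof.
move=> x y z; rewrite -[x]tsum_repr -[y]tsum_repr -[z]tsum_repr !taddE.
by rewrite catA.
Qed.

Lemma taddC : commutative tadd.
Proof. by move=> x y; apply/tsumP; exact: teq_comm. Qed.

Lemma tadd0 : left_id tzero tadd.
Proof. by move=> x; rewrite -[x]tsum_repr taddE. Qed.

Lemma tscale_mapE (a b c : k) s :
  c = a + b ->
  tadd (tsum (tscale_seq a s)) (tsum (tscale_seq b s)) = tsum (tscale_seq c s).
Proof.
move=> ->; elim: s => [|[m n] s IHs] /=; first by rewrite taddE.
rewrite -cat1s -[_ :: tscale_seq b s]cat1s -[RHS]/(tsum ([:: _] ++ _)).
rewrite -!taddE -IHs scalerDl.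
have -> : tsum [:: (a *: m + b *: m, n)]
          = tadd (tsum [:: (a *: m, n)]) (tsum [:: (b *: m, n)]).
  by rewrite taddE; apply/tsumP; exact: teq_addl.
rewrite -!taddA; congr tadd; rewrite !taddA; congr tadd.
exact: taddC.
Qed.

Lemma tscale0s s : tsum (tscale_seq 0 s) = tzero.
Proof.
elim: s => [//|[m n] s IHs] /=.
rewrite -cat1s -taddE IHs scale0r taddC tadd0.
by apply/tsumP; exact: teq_zero.
Qed.

Lemma tscale1 : left_id 1 tscale.
Proof.
move=> x; rewrite -[x]tsum_repr tscaleE; congr tsum.
by rewrite -[RHS]map_id; apply: eq_map => -[m n] /=; rewrite scale1r.
Qed.

Lemma taddN : left_inverse tzero topp tadd.
Proof.
move=> x; rewrite /topp -{2}[x]tscale1 -[x]tsum_repr !tscaleE.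
rewrite (@tscale_mapE _ _ 0) ?tscale0s //.
by rewrite addNr.
Qed.

HB.instance Definition _ := GRing.isZmodule.Build T taddA taddC tadd0 taddN.

Lemma tscaleA a b x : tscale a (tscale b x) = tscale (a * b) x.
Proof.
rewrite -[x]tsum_repr !tscaleE /tscale_seq -map_comp; congr tsum.
by apply: eq_map => p /=; rewrite scalerA.
Qed.

Lemma tscaleDr : right_distributive tscale +%R.
Proof.
move=> a x y; rewrite -[x]tsum_repr -[y]tsum_repr.
by rewrite -[_ + _]/(tadd _ _) -[RHS]/(tadd _ _) taddE !tscaleE taddE -map_cat.
Qed.

Lemma tscaleDl x : {morph tscale^~ x : a b / a + b}.
Proof.
move=> a b; rewrite -[x]tsum_repr !tscaleE; symmetry.
exact: tscale_mapE.
Qed.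

HB.instance Definition _ :=
  GRing.Zmodule_isLmodule.Build k T tscaleA tscale1 tscaleDr tscaleDl.

Lemma tsumE s : tsum s = \sum_(p <- s) pure p.1 p.2.
Proof.
elim: s => [|[m n] s IHs]; first by rewrite big_nil.
by rewrite big_cons -IHs -[RHS]/(tadd _ _) taddE.
Qed.

Lemma pure_bilinear : is_bilinear pure.
Proof.
split=> [n a m m' | m a n n'] /=.
- rewrite -[RHS]/(tadd (tscale _ _) _) tscaleE taddE.
  by apply/tsumP; exact: teq_addl.
- rewrite -[RHS]/(tadd (tscale _ _) _) tscaleE taddE; apply/tsumP.
  apply: teq_trans (teq_addr _ _ _) _.
  rewrite -cat1s -[X in tensor_eq _ X]cat1s.
  by apply: teq_cat; [apply/teq_sym/teq_scale | exact: teq_refl].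
Qed.

Lemma tensor_sum x :
  exists (n : nat) (u : 'I_n -> M) (v : 'I_n -> N), x = \sum_i pure (u i) (v i).
Proof.
exists (size (repr x)), (fun i => (nth (0, 0) (repr x) i).1).
exists (fun i => (nth (0, 0) (repr x) i).2).
by rewrite -{1}[x]tsum_repr tsumE (big_nth (0, 0)) big_mkord.
Qed.

Section Lift.
Variables (P : lmodType k) (f : M -> N -> P).

(* The linear map M (x) N -> P induced by f; meaningful for bilinear f. *)
Definition tlift x : P := \sum_(p <- repr x) f p.1 p.2.

Hypothesis fP : is_bilinear f.

Lemma tlift_tsum s : tlift (tsum s) = \sum_(p <- s) f p.1 p.2.
Proof.
have [fl fr] := fP.
have fDl m m' n : f (m + m') n = f m n + f m' n.
  by have := fl n 1 m m'; rewrite /= !scale1r.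
have fDr m n n' : f m (n + n') = f m n + f m n'.
  by have := fr m 1 n n'; rewrite /= !scale1r.
have f0l n : f 0 n = 0.
  by apply: (addrI (f 0 n)); rewrite -fDl !addr0.
have f0r m : f m 0 = 0.
  by apply: (addrI (f m 0)); rewrite -fDr !addr0.
have fZl a m n : f (a *: m) n = a *: f m n.
  by have := fl n a m 0; rewrite /= f0l !addr0.
have fZr a m n : f m (a *: n) = a *: f m n.
  by have := fr m a n 0; rewrite /= f0r !addr0.
have fE u v : tensor_eq u v ->
    \sum_(p <- u) f p.1 p.2 = \sum_(p <- v) f p.1 p.2.
  2: by apply: fE; exact: repr_tsum.
elim=> // {s u v}.
- by move=> s t u _ -> _ ->.
- by move=> s s' t t' _ h1 _ h2; rewrite !big_cat /= h1 h2.
- by move=> s t; rewrite !big_cat /= addrC.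
- by move=> n; rewrite big_seq1 big_nil /= f0l.
- by move=> m m' n; rewrite big_seq1 big_cons big_seq1 /= fDl.
- by move=> m n n'; rewrite big_seq1 big_cons big_seq1 /= fDr.
- by move=> a m n; rewrite !big_seq1 /= fZl fZr.
Qed.

Lemma tlift_pure m n : tlift (pure m n) = f m n.
Proof. by rewrite /pure tlift_tsum big_seq1. Qed.

Lemma tlift_linear : linear tlift.
Proof.
have [fl _] := fP.
move=> a x y; rewrite -[x]tsum_repr -[y]tsum_repr.
rewrite -[a *: _ + _]/(tadd (tscale _ _) _) tscaleE taddE !tlift_tsum.
rewrite big_cat /= big_map scaler_sumr; congr (_ + _).
apply: eq_bigr => -[m n] _ /=.
have f0 : f 0 n = 0.
  apply: (addrI (f 0 n)); have := fl n 1 0 0; rewrite /= !scale1r !addr0.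
  by move=> <-.
by have := fl n a m 0; rewrite /= f0 !addr0.
Qed.
End Lift.

Lemma eq_tensor_linear (P : lmodType k) (g h : T -> P) :
  linear g -> linear h -> (forall m n, g (pure m n) = h (pure m n)) -> g =1 h.
Proof.
move=> gP hP gh x.
have D (l : T -> P) : linear l -> l 0 = 0 /\ {morph l : u v / u + v}.
  move=> lP; have lD : {morph l : u v / u + v}.
    by move=> u v; have := lP 1 u v; rewrite !scale1r.
  by split=> //; apply: (addrI (l 0)); rewrite -lD !addr0.
have [g0 gD] := D _ gP; have [h0 hD] := D _ hP.
have [n [u [v ->]]] := tensor_sum x.
rewrite (big_morph g gD g0) (big_morph h hD h0).
by apply: eq_bigr => i _; exact: gh.
Qed.

Theorem tensor_universal (P : lmodType k) (f : M -> N -> P) :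
  is_bilinear f ->
  exists! g : T -> P, linear g /\ forall m n, g (pure m n) = f m n.
Proof.
move=> fP; exists (tlift f); split.
  by split=> [|m n]; [exact: tlift_linear | exact: tlift_pure].
move=> g [gl gE]; apply/funext/eq_tensor_linear => // [|m n].
  exact: tlift_linear.
by rewrite tlift_pure.
Qed.
End TensorModule.

Arguments pure {k M N}.

Section TensorMap2.
Variables (k : comPzRingType) (A M P B N Q : lmodType k).
Variables (f : A -> M -> P) (g : B -> N -> Q).

(* (a (x) b, u (x) v) |-> f a u (x) g b v, extended bilinearly. *)
Definition tmap2 (x : A ⊗ B) (y : M ⊗ N) : P ⊗ Q :=
  tlift (fun a b => tlift (fun u v => pure (f a u) (g b v)) y) x.

Hypotheses (fP : is_bilinear f) (gP : is_bilinear g).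

Lemma tmap2_innerP a b :
  is_bilinear (fun u v => pure (f a u) (g b v) : P ⊗ Q).
Proof.
have [pl pr] := pure_bilinear P Q.
split=> [v c u u' | u c v v'] /=.
- by rewrite fP.2; exact: pl.
- by rewrite gP.2; exact: pr.
Qed.

Lemma tmap2_outerP (y : M ⊗ N) :
  is_bilinear (fun a b => tlift (fun u v => pure (f a u) (g b v) : P ⊗ Q) y).
Proof.
have [pl pr] := pure_bilinear P Q.
split=> [b c a a' | a c b b'] /=; rewrite /tlift scaler_sumr -big_split /=;
  apply: eq_bigr => p _.
- by rewrite (fP.1 p.1); exact: pl.
- by rewrite (gP.1 p.2); exact: pr.
Qed.

Lemma tmap2_pure a b u v :
  tmap2 (pure a b) (pure u v) = pure (f a u) (g b v).
Proof.
rewrite /tmap2 tlift_pure; last exact: tmap2_outerP.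
by rewrite tlift_pure //; exact: tmap2_innerP.
Qed.

Lemma tmap2_bilinear : is_bilinear tmap2.
Proof.
split=> [y | x c y y']; first exact/tlift_linear/tmap2_outerP.
rewrite /tmap2 /(tlift _ x) scaler_sumr -big_split /=.
apply: eq_bigr => p _; apply: tlift_linear; exact: tmap2_innerP.
Qed.
End TensorMap2.

Lemma tmap2A (k : comPzRingType) (A B M N : lmodType k)
    (mA : A -> A -> A) (mB : B -> B -> B) (aM : A -> M -> M) (aN : B -> N -> N) :
  is_bilinear mA -> is_bilinear mB -> is_bilinear aM -> is_bilinear aN ->
  (forall a b x, aM (mA a b) x = aM a (aM b x)) ->
  (forall a b x, aN (mB a b) x = aN a (aN b x)) ->
  forall x y z, tmap2 aM aN (tmap2 mA mB x y) z
                = tmap2 aM aN x (tmap2 aM aN y z).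
Proof.
move=> mAP mBP aMP aNP AM AN x y z.
have [ml mr] := tmap2_bilinear mAP mBP.
have [al ar] := tmap2_bilinear aMP aNP.
move: x; apply: eq_tensor_linear => [c x x' | | a b].
- by rewrite ml al.
- exact: al.
move: y; apply: eq_tensor_linear => [c y y' | c y y' | a' b'].
- by rewrite mr al.
- by rewrite al ar.
move: z; apply: eq_tensor_linear => [|c z z' | u v].
- exact: ar.
- by rewrite !ar.
by rewrite !tmap2_pure // AM AN.
Qed.

Section TensorAlgebra.
Variables (k : comPzRingType) (A B : nuAlgType k).

Definition tensor_mul : A ⊗ B -> A ⊗ B -> A ⊗ B :=
  tmap2 (@amul k A) (@amul k B).

Lemma tensor_mulA : associative tensor_mul.
Proof.
move=> x y z; symmetry; apply: tmap2A; try exact: amul_bilinear.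
- by move=> a b c; rewrite amulA.
- by move=> a b c; rewrite amulA.
Qed.

HB.instance Definition _ := isNuAlgebra.Build k (A ⊗ B) tensor_mulA
  (tmap2_bilinear (@amul_bilinear k A) (@amul_bilinear k B)).
End TensorAlgebra.

Section TensorLeftModule.
Variables (k : comPzRingType) (A B : nuAlgType k).
Variables (M : leftModType A) (N : leftModType B).

Definition tensor_act : A ⊗ B -> M ⊗ N -> M ⊗ N :=
  tmap2 (@act k A M) (@act k B N).

Lemma tensor_actM (f g : A ⊗ B) (x : M ⊗ N) :
  tensor_act (amul f g) x = tensor_act f (tensor_act g x).
Proof.
by apply: tmap2A; try exact: amul_bilinear; try exact: act_bilinear;
  move=> a b u; exact: actM.
Qed.

HB.instance Definition _ := isLeftModule.Build k (A ⊗ B) (M ⊗ N)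
  (tmap2_bilinear (@act_bilinear k A M) (@act_bilinear k B N)) tensor_actM.

Lemma tensor_actE n (a : 'I_n -> A) (b : 'I_n -> B) (u : M) (v : N) :
  act (\sum_i pure (a i) (b i) : A ⊗ B) (pure u v : M ⊗ N)
  = \sum_i pure (act (a i) u) (act (b i) v).
Proof.
have [al _] := act_bilinear (s := (M ⊗ N : leftModType (A ⊗ B))).
have aD : {morph (act^~ (pure u v : M ⊗ N)) : x y / (x : A ⊗ B) + y >-> x + y}.
  by move=> x y; have := al (pure u v) 1 x y; rewrite /= !scale1r.
have a0 : act (0 : A ⊗ B) (pure u v : M ⊗ N) = 0.
  by apply: (addrI (act (0 : A ⊗ B) (pure u v : M ⊗ N))); rewrite -aD !addr0.
rewrite (big_morph (act^~ (pure u v : M ⊗ N)) aD a0).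
apply: eq_bigr => i _; apply: tmap2_pure; exact: act_bilinear.
Qed.
End TensorLeftModule.

(* Main.v *)
From HB Require Import structures.
Require Import Defs.
From mathcomp Require Import all_boot all_algebra.
From mathcomp Require Import boolp classical_sets.

(** Let [x] in [A ⊗ B] act as zero on [M ⊗ N].  The second factors of the
    finitely many pure tensors making up [x] lie in a free submodule of [B], so
    [x] can be rewritten as a sum of [a e ⊗ e] over distinct elements [e] of a
    basis ([tensor_basis_expansion]).  A linear form [phi] on [M] contracts
    [M ⊗ N] to [N] by [u ⊗ v |-> phi u *: v]; applied to
    [x (u ⊗ v) = 0] it says that the element [\sum_e phi (a e u) *: e] of [B]
    kills every [v] in [N].  Faithfulness of [N] makes this element zero, and
    linear independence of the [e] then gives [phi (a e u) = 0] for every [e].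
    As the forms [phi] separate [M], [a e u = 0] for all [u], so [a e = 0] by
    faithfulness of [M], and [x = 0]. *)

Set Implicit Arguments.
Unset Strict Implicit.
Unset Printing Implicit Defensive.

Import GRing.Theory.
Local Open Scope ring_scope.

Section LinearFunctions.
Variables (k : comPzRingType) (U V : lmodType k) (f : U -> V).
Hypothesis fP : linear f.

(* Bilinearity gives bare [linear] proofs for partial applications; packing
   them gives access to the theory of {linear _ -> _}. *)
Let g : {linear U -> V} := HB.pack f (GRing.isLinear.Build k U V *:%R f fP).

Lemma linear_fun0 : f 0 = 0.
Proof. exact: (linear0 g). Qed.

Lemma linear_funB : {morph f : u v / u - v}.
Proof. exact: (linearB g). Qed.

Lemma linear_funZ (c : k) (u : U) : f (c *: u) = c *: f u.
Proof. exact: (linearZ_LR g). Qed.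

Lemma linear_fun_sum (I : Type) (r : seq I) (P : pred I) (F : I -> U) :
  f (\sum_(i <- r | P i) F i) = \sum_(i <- r | P i) f (F i).
Proof. exact: (linear_sum g). Qed.
End LinearFunctions.

Section BasisExpansion.
Variables (k : comPzRingType) (A B : lmodType k).
Implicit Types (E F : set B) (l : seq (A * B)).

(** Scalars move across the tensor sign, so the coefficients of [b] can be
    absorbed into the left factor. *)
Lemma pure_span_expansion E F (a : A) (b : B) :
  is_span E F -> F b ->
  exists l, (forall p, p \in l -> E p.2) /\
    pure a b = \sum_(p <- l) pure p.1 p.2.
Proof.
have [pl pr] := pure_bilinear A B.
move=> spanF /spanF[s [c [sE ->]]].
exists [seq (c e *: a, e) | e <- s]; split.
  by move=> _ /mapP[e es ->]; exact: sE.
rewrite big_map (linear_fun_sum (pr a)); apply: eq_bigr => e _ /=.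
by rewrite (linear_funZ (pr a)) (linear_funZ (pl e)).
Qed.

Lemma tsum_span_expansion E F l :
  is_span E F -> (forall p, p \in l -> F p.2) ->
  exists l', (forall p, p \in l' -> E p.2) /\
    \sum_(p <- l) pure p.1 p.2 = \sum_(p <- l') pure p.1 p.2.
Proof.
move=> spanF; elim: l => [|[a b] l IHl] lF; first by exists [::].
have [|l2 [l2E eq2]] := IHl.
  by move=> p pl; apply: lF; rewrite inE pl orbT.
have [|l1 [l1E eq1]] := @pure_span_expansion E F a b spanF.
  by apply: (lF (a, b)); rewrite mem_head.
exists (l1 ++ l2); split; last by rewrite big_cons big_cat /= eq1 eq2.
by move=> p; rewrite mem_cat => /orP[/l1E | /l2E].
Qed.

(** Collects the pure tensors that share a right factor, so that linear
    independence, which concerns distinct vectors, becomes applicable. *)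
Lemma pure_sum_collect l :
  \sum_(p <- l) pure p.1 p.2 =
  \sum_(e <- undup (unzip2 l)) pure (\sum_(p <- l | p.2 == e) p.1) e.
Proof.
have [pl _] := pure_bilinear A B.
have -> : \sum_(e <- undup (unzip2 l)) pure (\sum_(p <- l | p.2 == e) p.1) e
    = \sum_(e <- undup (unzip2 l)) \sum_(p <- l | p.2 == e) pure p.1 p.2.
  apply: eq_bigr => e _; rewrite (linear_fun_sum (pl e)).
  by apply: eq_bigr => p /eqP ->.
rewrite (exchange_big_dep predT) //= big_seq [RHS]big_seq.
apply: eq_bigr => p p_l.
under eq_bigl do rewrite eq_sym.
rewrite -big_filter filter_pred1_uniq ?undup_uniq ?big_seq1 //.
by rewrite mem_undup map_f.
Qed.

Lemma tensor_basis_expansion (x : A ⊗ B) :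
  (forall s : seq B,
     exists F : set B, free_submodule F /\ (forall b, b \in s -> F b)) ->
  exists (E : set B) (s : seq B) (a : B -> A),
    [/\ linearly_independent E, uniq s, forall e, e \in s -> E e
      & x = \sum_(e <- s) pure (a e) e].
Proof.
move=> freeB; have [F [[_ [E [indE spanF]]] xF]] := freeB (unzip2 (repr x)).
have [|l [lE eq_l]] := @tsum_span_expansion E F (repr x) spanF.
  by move=> p p_x; apply: xF; exact: map_f.
exists E, (undup (unzip2 l)), (fun e => \sum_(p <- l | p.2 == e) p.1).
split=> //; first exact: undup_uniq.
  by move=> _ /[!mem_undup] /mapP[p /lE ? ->].
by rewrite -pure_sum_collect -eq_l -tsumE tsum_repr.
Qed.
End BasisExpansion.

Lemma contraction_bilinear (k : comPzRingType) (M N : lmodType k)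
    (phi : {scalar M}) : is_bilinear (fun (u : M) (v : N) => phi u *: v).
Proof.
split=> [v c u u' | u c v v'] /=.
- by rewrite linearP /= scalerDl scalerA.
- by rewrite scalerDr !scalerA mulrC.
Qed.

(** Contracting by [phi] turns vanishing of the action on pure tensors into a
    relation in [N], which faithfulness of [N] lifts to [B]. *)
Lemma act0_contraction (k : comPzRingType) (A B : nuAlgType k)
    (M : leftModType A) (N : leftModType B) (phi : {scalar M})
    (s : seq B) (a : B -> A) (u : M) :
  faithful N ->
  (forall v : N, act (\sum_(e <- s) pure (a e) e : A ⊗ B)
                     (pure u v : M ⊗ N) = 0) ->
  \sum_(e <- s) phi (act (a e) u) *: e = 0.
Proof.
move=> faithN act0; apply: faithN => v.
have [nl _] := act_bilinear (s := N).
have [tl _] := act_bilinear (s := (M ⊗ N : leftModType (A ⊗ B))).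
have phiP := contraction_bilinear N phi.
rewrite (linear_fun0 (nl v)) (linear_fun_sum (nl v)).
pose contract := tlift (fun (u : M) (v : N) => phi u *: v).
have cP : linear contract := tlift_linear phiP.
have contract0 : contract (act (\sum_(e <- s) pure (a e) e : A ⊗ B)
                               (pure u v : M ⊗ N)) = 0.
  by rewrite act0 (linear_fun0 cP).
rewrite -[RHS]contract0.
rewrite (linear_fun_sum (tl (pure u v))) (linear_fun_sum cP).
apply: eq_bigr => e _.
rewrite (linear_funZ (nl v)) [act (pure _ _) _]tmap2_pure; first last.
- exact: act_bilinear.
- exact: act_bilinear.
by rewrite /contract tlift_pure.
Qed.

Theorem corollary2 (k : comPzRingType) (A B : nuAlgType k)
    (M : leftModType A) (N : leftModType B)
    (faithM : faithful M) (faithN : faithful N)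
    (sepM : forall x y : M, x <> y ->
       exists phi : {scalar M}, phi x <> phi y)
    (freeB : forall s : seq B,
       exists F : set B, free_submodule F /\ (forall b, b \in s -> F b)) :
  faithful (M ⊗ N : leftModType (A ⊗ B)).
Proof.
move=> x y xy; apply/eqP; rewrite -subr_eq0; apply/eqP.
have [tl _] := act_bilinear (s := (M ⊗ N : leftModType (A ⊗ B))).
have act0 z : act (x - y) (z : M ⊗ N) = 0.
  by rewrite (linear_funB (tl z)) xy subrr.
have [E [s [a [indE s_uniq sE eq_s]]]] := tensor_basis_expansion (x - y) freeB.
have [pl _] := pure_bilinear A B.
rewrite eq_s big_seq big1 // => e e_s.
suff -> : a e = 0 by exact: (linear_fun0 (pl e)).
have [ml _] := act_bilinear (s := M).
apply: faithM => u; rewrite (linear_fun0 (ml u)).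
apply: contrapT => /sepM[phi]; apply; rewrite linear0.
apply: (indE s (fun e => phi (act (a e) u))) => //.
by apply: act0_contraction faithN _ => v; rewrite -eq_s.
Qed.
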